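(* Let $f \colon A \to B$ be a surjective homomorphism of quandles. The following conditions are equivalent: (1) $f$ is an algebraically central extension with abelian symmetric fibers; (2) $f$ is a normal extension; (3) $f$ is a central extension. (Here normal and central extensions are understood with respect to the reflection $I$ of the category of quandles onto its subvariety of abelian symmetric quandles.)
   Context: A quandle is a set $A$ with two binary operations $\lhd, \lhd^{-1}$ such that for all $a,b,c\in A$: $a\lhd a=a=a\lhd^{-1}a$; $(a\lhd b)\lhd^{-1}b=a=(a\lhd^{-1}b)\lhd b$; $(a\lhd b)\lhd c=(a\lhd c)\lhd(b\lhd c)$ and $(a\lhd^{-1} b)\lhd^{-1} c=(a\lhd^{-1} c)\lhd^{-1}(b\lhd^{-1} c)$. Homomorphisms preserve both operations; the resulting category (a variety of universal algebras) is $\mathsf{Qnd}$. A quandle is symmetric if $a\lhd b=b\lhd a$ for all $a,b$, and abelian if $(a\lhd b)\lhd(c\lhd d)=(a\lhd c)\lhd(b\lhd d)$ for all $a,b,c,d$. $\mathsf{AbSymQnd}$ is the full subcategory (subvariety) of quandles that are both abelian and symmetric; the inclusion $H\colon \mathsf{AbSymQnd}\to\mathsf{Qnd}$ has a left adjoint $I\colon\mathsf{Qnd}\to\mathsf{AbSymQnd}$, with unit $\eta_A\colon A\to HI(A)$ (each $\eta_A$ is surjective). A homomorphism $f\colon A\to B$ has abelian symmetric fibers if for every $b\in B$ the subquandle $f^{-1}(b)=\{a\in A\mid f(a)=b\}$ of $A$ is an abelian symmetric quandle. $\mathsf{Eq}(f)=\{(a_1,a_2)\in A\times A\mid f(a_1)=f(a_2)\}$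 is the kernel congruence of $f$, with projections $f_1,f_2\colon\mathsf{Eq}(f)\to A$. For congruences $R,S$ on a quandle $A$, let $R\times_A S=\{(x,y,z)\in A^3\mid (x,y)\in R,\ (y,z)\in S\}$ (a subquandle of $A^3$). A connector between $R$ and $S$ is a quandle homomorphism $p\colon R\times_A S\to A$ such that, whenever the expressions are defined: $p(x,x,y)=y$; $p(x,y,y)=x$; $(x,p(x,y,z))\in S$; $(z,p(x,y,z))\in R$; $p(x,y,p(y,u,v))=p(x,u,v)$; $p(p(x,y,u),u,v)=p(x,u,v)$. (There is a connector between $R$ and $S$ if and only if there is one between $S$ and $R$.) A surjective homomorphism $f\colon A\to B$ with abelian symmetric fibers is an algebraically central extension if there is a connector between $\mathsf{Eq}(f)$ and the largest congruence $A\times A$. A surjective homomorphism $g\colon X\to Y$ in $\mathsf{Qnd}$ is a trivial extension if the naturality square with $HI(g)\circ\eta_X=\eta_Y\circ g$ is a pullback. A surjective homomorphism $f\colon A\to B$ is a central extension if there is a surjective homomorphism $p\colon E\to B$ such that the projection $\pi_1\colon E\times_B A\to E$ of the pullback of $f$ along $p$ is a trivial extension. A surjective homomorphism $f\colon A\to B$ is a normal extension if $f_1\colon\mathsf{Eq}(f)\to A$ is a trivial extension.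
   Formalization: The last connector axiom is taken as p(p(x,y,u),u,v) = p(x,y,v) instead of the printed p(p(x,y,u),u,v) = p(x,u,v), which would force f to be injective and make the equivalence false. *)

(* Defs.v *)
From Stdlib Require Import ssreflect ssrfun.
From Stdlib Require Import RelationClasses.
From Stdlib Require Import FunctionalExtensionality PropExtensionality.
From Stdlib Require Import ProofIrrelevance IndefiniteDescription.

Set Implicit Arguments.
Unset Strict Implicit.
Unset Printing Implicit Defensive.

Declare Scope quandle_scope.
Delimit Scope quandle_scope with quandle.
Local Open Scope quandle_scope.

Record quandle := Quandle {
  carrier :> Type;
  qop : carrier -> carrier -> carrier;
  qinv : carrier -> carrier -> carrier;
  qop_idem : forall a, qop a a = a;
  qinv_idem : forall a, qinv a a = a;
  qopK : forall a b, qinv (qop a b) b = a;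
  qinvK : forall a b, qop (qinv a b) b = a;
  qop_dist : forall a b c, qop (qop a b) c = qop (qop a c) (qop b c);
  qinv_dist : forall a b c, qinv (qinv a b) c = qinv (qinv a c) (qinv b c)
}.

Arguments qop {_} _ _.
Arguments qinv {_} _ _.

Notation "a <| b" := (qop a b) (at level 40, left associativity) : quandle_scope.
Notation "a <|^-1 b" := (qinv a b) (at level 40, left associativity) : quandle_scope.

Record hom (A B : quandle) := Hom {
  hom_fun :> A -> B;
  hom_op : forall a b, hom_fun (a <| b) = hom_fun a <| hom_fun b;
  hom_inv : forall a b, hom_fun (a <|^-1 b) = hom_fun a <|^-1 hom_fun b
}.

Definition surjective (A B : quandle) (f : hom A B) : Prop :=
  forall b, exists a, f a = b.

Definition comp_hom (A B C : quandle) (g : hom B C) (f : hom A B) : hom A C.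
Proof.
exists (fun a => g (f a)) => a b; by rewrite ?hom_op ?hom_inv.
Defined.

Definition is_symmetric (A : quandle) : Prop := forall a b : A, a <| b = b <| a.

Definition is_abelian (A : quandle) : Prop :=
  forall a b c d : A, (a <| b) <| (c <| d) = (a <| c) <| (b <| d).

Definition prod_quandle (A B : quandle) : quandle.
Proof.
exists (A * B)%type
  (fun u v => (u.1 <| v.1, u.2 <| v.2))
  (fun u v => (u.1 <|^-1 v.1, u.2 <|^-1 v.2)).
- by case=> a b /=; rewrite !qop_idem.
- by case=> a b /=; rewrite !qinv_idem.
- by case=> a b u /=; rewrite !qopK.
- by case=> a b u /=; rewrite !qinvK.
- by move=> u v w /=; rewrite -!qop_dist.
- by move=> u v w /=; rewrite -!qinv_dist.
Defined.

Record sub_closed (A : quandle) (P : A -> Prop) : Prop := SubClosed {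
  closed_op : forall a b, P a -> P b -> P (a <| b);
  closed_inv : forall a b, P a -> P b -> P (a <|^-1 b)
}.

Definition sub_quandle (A : quandle) (P : A -> Prop) (cP : sub_closed P) :
  quandle.
Proof.
exists {a : A | P a}
  (fun u v => exist P (proj1_sig u <| proj1_sig v)
                      (closed_op cP (proj2_sig u) (proj2_sig v)))
  (fun u v => exist P (proj1_sig u <|^-1 proj1_sig v)
                      (closed_inv cP (proj2_sig u) (proj2_sig v))).
- by case=> a pa; apply: subset_eq_compat; rewrite /= qop_idem.
- by case=> a pa; apply: subset_eq_compat; rewrite /= qinv_idem.
- by case=> a pa [b pb]; apply: subset_eq_compat; rewrite /= qopK.
- by case=> a pa [b pb]; apply: subset_eq_compat; rewrite /= qinvK.
- by move=> u v w; apply: subset_eq_compat; rewrite /= qop_dist.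
- by move=> u v w; apply: subset_eq_compat; rewrite /= qinv_dist.
Defined.

Lemma fiber_closed (A B : quandle) (f : hom A B) (b : B) :
  sub_closed (fun a : A => f a = b).
Proof.
split=> x y fx fy; first by rewrite hom_op fx fy qop_idem.
by rewrite hom_inv fx fy qinv_idem.
Qed.

Definition fiber (A B : quandle) (f : hom A B) (b : B) : quandle :=
  sub_quandle (fiber_closed f b).

Definition abelian_symmetric_fibers (A B : quandle) (f : hom A B) : Prop :=
  forall b : B, is_abelian (fiber f b) /\ is_symmetric (fiber f b).

Record congruence (A : quandle) := Congruence {
  cong_rel :> A -> A -> Prop;
  cong_equiv : Equivalence cong_rel;
  cong_op : forall a a' b b',
    cong_rel a a' -> cong_rel b b' -> cong_rel (a <| b) (a' <| b');
  cong_inv : forall a a' b b',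
    cong_rel a a' -> cong_rel b b' -> cong_rel (a <|^-1 b) (a' <|^-1 b')
}.

Definition kernel_congruence (A B : quandle) (f : hom A B) : congruence A.
Proof.
exists (fun a b => f a = f b).
- by split=> // [x y z -> ->].
- by move=> a a' b b' ha hb; rewrite !hom_op ha hb.
- by move=> a a' b b' ha hb; rewrite !hom_inv ha hb.
Defined.

Definition total_congruence (A : quandle) : congruence A.
Proof. by exists (fun _ _ => True). Defined.

Lemma cong_closed (A : quandle) (R : congruence A) :
  sub_closed (A := prod_quandle A A) (fun u => R u.1 u.2).
Proof.
split=> u v hu hv; [exact: cong_op hu hv | exact: cong_inv hu hv].
Qed.

Definition cong_quandle (A : quandle) (R : congruence A) : quandle :=
  sub_quandle (cong_closed R).

Definition cong_fst (A : quandle) (R : congruence A) : hom (cong_quandle R) A.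
Proof. by exists (fun u => (proj1_sig u).1). Defined.

Definition composable (A : quandle) (R S : congruence A)
  (t : prod_quandle (prod_quandle A A) A) : Prop :=
  let: (x, y, z) := t in R x y /\ S y z.

Lemma composable_closed (A : quandle) (R S : congruence A) :
  sub_closed (composable R S).
Proof.
by split; move=> [[x y] z] [[x' y'] z'] [r s] [r' s'] /=; split;
  first [exact: cong_op | exact: cong_inv].
Qed.

Definition cong_pullback (A : quandle) (R S : congruence A) : quandle :=
  sub_quandle (composable_closed R S).

Definition triple (A : quandle) (R S : congruence A) (x y z : A)
  (r : R x y) (s : S y z) : cong_pullback R S :=
  exist (composable R S) (x, y, z) (conj r s).

(* [p(x, y, z)] is defined exactly when there are [r : R x y] and [s : S y z];
   each identity is required for all proofs making both of its sides defined. *)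
Record is_connector (A : quandle) (R S : congruence A)
  (p : hom (cong_pullback R S) A) : Prop := IsConnector {
  connector_left : forall (x y : A) (r : R x x) (s : S x y),
    p (triple r s) = y;
  connector_right : forall (x y : A) (r : R x y) (s : S y y),
    p (triple r s) = x;
  connector_S : forall (x y z : A) (r : R x y) (s : S y z),
    S x (p (triple r s));
  connector_R : forall (x y z : A) (r : R x y) (s : S y z),
    R z (p (triple r s));
  connector_assoc_left : forall (x y u v : A)
    (yu : R y u) (uv : S u v) (xy : R x y) (s : S y (p (triple yu uv)))
    (xu : R x u),
    p (triple xy s) = p (triple xu uv);
  connector_assoc_right : forall (x y u v : A)
    (xy : R x y) (yu : S y u) (r : R (p (triple xy yu)) u) (uv : S u v)
    (yv : S y v),
    p (triple r uv) = p (triple xy yv)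
}.

Definition algebraically_central (A B : quandle) (f : hom A B) : Prop :=
  surjective f /\ abelian_symmetric_fibers f /\
  exists p : hom (cong_pullback (kernel_congruence f) (total_congruence A)) A,
    is_connector p.

Section Quotient.

Variables (A : quandle) (R : congruence A).

Definition quotient_carrier : Type := {P : A -> Prop | exists a, P = R a}.

Definition class_of (a : A) : quotient_carrier :=
  exist _ (R a) (ex_intro _ a eq_refl).

Definition repr (P : quotient_carrier) : A :=
  proj1_sig (constructive_indefinite_description _ (proj2_sig P)).

Lemma class_of_eq (a b : A) : class_of a = class_of b <-> R a b.
Proof.
have [Rr Rs Rt] := cong_equiv R; split.
  by move=> /(f_equal (@proj1_sig _ _)) /= ->; apply: Rr.
move=> Rab; apply: subset_eq_compat; apply: functional_extensionality => c.
by apply: propositional_extensionality; split; apply: Rt; [apply: Rs|].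
Qed.

Lemma reprK (P : quotient_carrier) : class_of (repr P) = P.
Proof.
case: P => P hP; apply: subset_eq_compat; rewrite /repr /=.
by case: constructive_indefinite_description => a /= ->.
Qed.

Lemma repr_class_of (a : A) : R (repr (class_of a)) a.
Proof. by apply/class_of_eq; rewrite reprK. Qed.

Definition quotient_op (P Q : quotient_carrier) : quotient_carrier :=
  class_of (repr P <| repr Q).

Definition quotient_inv (P Q : quotient_carrier) : quotient_carrier :=
  class_of (repr P <|^-1 repr Q).

Lemma class_of_op (a b : A) :
  class_of (a <| b) = quotient_op (class_of a) (class_of b).
Proof.
have [Rr Rs Rt] := cong_equiv R.
by apply/class_of_eq; apply: Rs; apply: cong_op; apply: repr_class_of.
Qed.

Lemma class_of_inv (a b : A) :
  class_of (a <|^-1 b) = quotient_inv (class_of a) (class_of b).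
Proof.
have [Rr Rs Rt] := cong_equiv R.
by apply/class_of_eq; apply: Rs; apply: cong_inv; apply: repr_class_of.
Qed.

Definition quotient : quandle.
Proof.
exists quotient_carrier quotient_op quotient_inv.
- by move=> P; rewrite -(reprK P) -class_of_op qop_idem.
- by move=> P; rewrite -(reprK P) -class_of_inv qinv_idem.
- move=> P Q; rewrite -(reprK P) -(reprK Q).
  by rewrite -class_of_op -class_of_inv qopK.
- move=> P Q; rewrite -(reprK P) -(reprK Q).
  by rewrite -class_of_inv -class_of_op qinvK.
- move=> P Q T; rewrite -(reprK P) -(reprK Q) -(reprK T).
  by rewrite -!class_of_op qop_dist.
- move=> P Q T; rewrite -(reprK P) -(reprK Q) -(reprK T).
  by rewrite -!class_of_inv qinv_dist.
Defined.

Definition quotient_map : hom A quotient :=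
  @Hom A quotient class_of class_of_op class_of_inv.

End Quotient.

Record absym_quandle := AbsymQuandle {
  absym_base :> quandle;
  absym_abelian : is_abelian absym_base;
  absym_symmetric : is_symmetric absym_base
}.

(* The smallest congruence whose quotient is abelian and symmetric. *)
Definition absym_congruence (A : quandle) : congruence A.
Proof.
exists (fun a b => forall S : congruence A,
          is_abelian (quotient S) -> is_symmetric (quotient S) -> S a b).
- split.
  + by move=> a S _ _; case: (cong_equiv S) => Sr _ _.
  + move=> a b ab S aS sS; case: (cong_equiv S) => _ Ss _.
    by apply: Ss; apply: ab.
  + move=> a b c ab bc S aS sS; case: (cong_equiv S) => _ _ St.
    by apply: St (ab S aS sS) (bc S aS sS).
- by move=> a a' b b' ha hb S aS sS; apply: cong_op; [apply: ha | apply: hb].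
- by move=> a a' b b' ha hb S aS sS; apply: cong_inv; [apply: ha | apply: hb].
Defined.

Lemma absym_quotient_abelian (A : quandle) :
  is_abelian (quotient (absym_congruence A)).
Proof.
move=> P Q T U; rewrite -(reprK P) -(reprK Q) -(reprK T) -(reprK U).
rewrite /= -!class_of_op; apply/class_of_eq => S aS sS.
by apply/class_of_eq; rewrite !class_of_op; apply: aS.
Qed.

Lemma absym_quotient_symmetric (A : quandle) :
  is_symmetric (quotient (absym_congruence A)).
Proof.
move=> P Q; rewrite -(reprK P) -(reprK Q).
rewrite /= -!class_of_op; apply/class_of_eq => S aS sS.
by apply/class_of_eq; rewrite !class_of_op; apply: sS.
Qed.

Definition reflection (A : quandle) : absym_quandle :=
  AbsymQuandle (@absym_quotient_abelian A) (@absym_quotient_symmetric A).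

Definition eta (A : quandle) : hom A (reflection A) :=
  quotient_map (absym_congruence A).

Lemma eta_surjective (A : quandle) : surjective (eta A).
Proof. by move=> P; exists (repr P); apply: reprK. Qed.

Lemma absym_hom_factors (A : quandle) (B : absym_quandle) (f : hom A B)
  (a b : A) : absym_congruence A a b -> f a = f b.
Proof.
move=> ab; apply: (ab (kernel_congruence f)).
  move=> P Q T U; rewrite -(reprK P) -(reprK Q) -(reprK T) -(reprK U).
  rewrite /= -!class_of_op; apply/class_of_eq => /=.
  by rewrite !hom_op; apply: absym_abelian.
move=> P Q; rewrite -(reprK P) -(reprK Q).
rewrite /= -!class_of_op; apply/class_of_eq => /=.
by rewrite !hom_op; apply: absym_symmetric.
Qed.

Lemma lift_repr (A : quandle) (B : absym_quandle) (f : hom A B) (a : A) :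
  f (repr (eta A a)) = f a.
Proof. exact/absym_hom_factors/repr_class_of. Qed.

Definition reflection_lift (A : quandle) (B : absym_quandle) (f : hom A B) :
  hom (reflection A) B.
Proof.
exists (fun P : reflection A => f (repr P)) => P Q.
  by rewrite -hom_op; apply: lift_repr.
by rewrite -hom_inv; apply: lift_repr.
Defined.

Lemma reflection_universal (A : quandle) (B : absym_quandle) (f : hom A B) :
  (forall a, reflection_lift f (eta A a) = f a) /\
  (forall g : hom (reflection A) B, (forall a, g (eta A a) = f a) ->
     forall P, g P = reflection_lift f P).
Proof.
split=> [a|g gf P]; first exact: lift_repr.
by have [a <-] := eta_surjective P; rewrite gf; apply/esym/lift_repr.
Qed.

Definition reflection_map (A B : quandle) (g : hom A B) :
  hom (reflection A) (reflection B) :=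
  reflection_lift (comp_hom (eta B) g).

(* The universal property of a pullback in the category of quandles, for the
   square
<<
        h
    P ----> X
    |       |
  k |       | u
    v       v
    Y ----> Z
        v
>>
*)
Definition is_pullback (P X Y Z : quandle)
  (h : hom P X) (k : hom P Y) (u : hom X Z) (v : hom Y Z) : Prop :=
  (forall t, u (h t) = v (k t)) /\
  forall (Q : quandle) (h' : hom Q X) (k' : hom Q Y),
    (forall t, u (h' t) = v (k' t)) ->
    exists m : hom Q P,
      ((forall t, h (m t) = h' t) /\ (forall t, k (m t) = k' t)) /\
      forall m' : hom Q P,
        (forall t, h (m' t) = h' t) -> (forall t, k (m' t) = k' t) ->
        forall t, m' t = m t.

Lemma fiber_product_closed (E A B : quandle) (p : hom E B) (f : hom A B) :
  sub_closed (A := prod_quandle E A) (fun u => p u.1 = f u.2).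
Proof.
split=> u v hu hv /=; first by rewrite !hom_op hu hv.
by rewrite !hom_inv hu hv.
Qed.

Definition fiber_product (E A B : quandle) (p : hom E B) (f : hom A B) :
  quandle := sub_quandle (fiber_product_closed p f).

Definition fiber_product_fst (E A B : quandle) (p : hom E B) (f : hom A B) :
  hom (fiber_product p f) E.
Proof. by exists (fun u => (proj1_sig u).1). Defined.

Definition trivial_extension (X Y : quandle) (g : hom X Y) : Prop :=
  surjective g /\ is_pullback (eta X) g (reflection_map g) (eta Y).

Definition central_extension (A B : quandle) (f : hom A B) : Prop :=
  surjective f /\
  exists (E : quandle) (p : hom E B),
    surjective p /\ trivial_extension (fiber_product_fst p f).

Definition normal_extension (A B : quandle) (f : hom A B) : Prop :=
  surjective f /\ trivial_extension (cong_fst (kernel_congruence f)).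

(* Main.v *)
Require Import Defs.
From Stdlib Require Import ssreflect ssrfun ssrbool ProofIrrelevance IndefiniteDescription.

(** The term [m(x, y, z) = (z <| x) <|^-1 y] satisfies [m(x, x, z) = z] in every
    quandle, and [m(x, y, y) = x] as soon as [x] and [y] commute; it is a
    homomorphism on every abelian quandle.  Hence the kernel of
    [eta X : X -> I X] permutes with every congruence on [X], and a surjective
    [g : X -> Y] is a trivial extension iff [Eq (eta X)] and [Eq g] intersect
    trivially.

    If [f] is central, split by [p : E -> B], its fibers embed into
    [I (E *_B A)], so they are abelian and symmetric.  Given [(a, b)] and
    [(a, c)] with the same image in [I (Eq f)], permutability yields [e], [e']
    such that [(e, b)], [(e', c)] on the one hand, [(e, a)], [(e', a)] on the
    other, are identified in [I (E *_B A)].  Then so are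
    [m((e, b), (e, a), (e, a)) = (e, b)] and
    [m((e', c), (e', a), (e, a)) = (e, c)], whence [b = c].

    If [f] is normal, [m] is a connector: [m(x, y, z)] is the second component of
    [m((y, x), (y, y), (z, z)) = (z, m(x, y, z))] in [Eq f], and an element of
    [Eq f] is determined by its first component and its image in [I (Eq f)].
    Conversely, for a connector [p] and [z] in [A], the map
    [(a, b) |-> p(b, a, z)] is a homomorphism from [Eq f] to an abelian symmetric
    fiber, which sends [(z, b)] to [b]. *)

Set Implicit Arguments.
Unset Strict Implicit.
Unset Printing Implicit Defensive.
Local Open Scope quandle_scope.

(** * The term [malcev] *)

Definition malcev (A : quandle) (x y z : A) : A := (z <| x) <|^-1 y.

Lemma hom_malcev (A B : quandle) (f : hom A B) (x y z : A) :
  f (malcev x y z) = malcev (f x) (f y) (f z).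
Proof. by rewrite /malcev hom_inv hom_op. Qed.

Lemma malcev_left (A : quandle) (x z : A) : malcev x x z = z.
Proof. exact: qopK. Qed.

Lemma malcev_right (A : quandle) (x y : A) : x <| y = y <| x -> malcev x y y = x.
Proof. by rewrite /malcev => <-; apply: qopK. Qed.

(** Right translation by [b <| b'] is injective and, using abelianness on the right, turns both
    sides into [(c <| c') <| (a <| a')]. *)
Lemma malcev_op (A : quandle) (a b c a' b' c' : A) : is_abelian A ->
  malcev (a <| a') (b <| b') (c <| c') = malcev a b c <| malcev a' b' c'.
Proof.
move=> abA; rewrite -[RHS](qopK _ (b <| b')) [in RHS]abA.
by rewrite /malcev !qinvK [in RHS]abA.
Qed.

Definition hom_of_op (A B : quandle) (f : A -> B)
  (f_op : forall a b, f (a <| b) = f a <| f b) : hom A B.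
Proof.
exists f => // a b.
by rewrite -[LHS](qopK _ (f b)) -f_op qinvK.
Defined.

Definition const_hom (A B : quandle) (b : B) : hom A B.
Proof. by exists (fun=> b) => *; rewrite ?qop_idem ?qinv_idem. Defined.

Lemma sub_quandle_eq (A : quandle) (P : A -> Prop) (cP : sub_closed P)
  (u v : sub_quandle cP) : proj1_sig u = proj1_sig v -> u = v.
Proof. by case: u v => [x px] [y py] /= xy; apply: subset_eq_compat. Qed.

Definition pair_hom (Q A B : quandle) (h : hom Q A) (k : hom Q B) :
  hom Q (prod_quandle A B).
Proof. by exists (fun t => (h t, k t)) => u v; rewrite ?hom_op ?hom_inv. Defined.

Definition corestrict (Q A : quandle) (P : A -> Prop) (cP : sub_closed P)
  (h : hom Q A) (hP : forall t, P (h t)) : hom Q (sub_quandle cP).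
Proof.
exists (fun t => exist P (h t) (hP t)) => u v; apply: sub_quandle_eq.
  exact: hom_op.
exact: hom_inv.
Defined.

(** * Permutability and trivial extensions *)

Lemma eta_hom (A B : quandle) (f : hom A B) (x y : A) :
  eta A x = eta A y -> eta B (f x) = eta B (f y).
Proof.
by move=> /class_of_eq; apply: (absym_hom_factors (comp_hom (eta B) f)).
Qed.

Lemma eta_malcev_right (A : quandle) (x y : A) :
  eta A (malcev x y y) = eta A x.
Proof. by rewrite hom_malcev malcev_right //; apply: absym_symmetric. Qed.

Lemma eta_permutes (X Y : quandle) (g : hom X Y) (x y z : X) :
  g x = g y -> eta X y = eta X z -> exists w, eta X x = eta X w /\ g w = g z.
Proof.
move=> gxy yz; exists (malcev x y z); split; last first.
  by rewrite hom_malcev gxy malcev_left.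
by rewrite -(eta_malcev_right x y) !hom_malcev yz.
Qed.

Section ImageOfEta.

Variables (X Y : quandle) (g : hom X Y) (sg : surjective g).

(** The direct image of the kernel of [eta X] along [g]; permutability gives its transitivity. *)
Definition image_congruence : congruence Y.
Proof.
exists (fun y y' => exists x x', [/\ g x = y, g x' = y' & eta X x = eta X x']).
- split.
  + by move=> y; have [x gx] := sg y; exists x, x.
  + by move=> y y' [x [x' [gx gx' e]]]; exists x', x.
  + move=> y1 y2 y3 [x [x' [gx gx' e]]] [z [z' [gz gz' e']]].
    have [|w [ew gw]] := @eta_permutes X Y g x' z z' _ e'; first by rewrite gx' gz.
    by exists x, w; rewrite gw e.
- move=> a a' b b' [x [x' [<- <- e]]] [z [z' [<- <- e']]].
  by exists (x <| z), (x' <| z'); rewrite !hom_op e e'.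
- move=> a a' b b' [x [x' [<- <- e]]] [z [z' [<- <- e']]].
  by exists (x <|^-1 z), (x' <|^-1 z'); rewrite !hom_inv e e'.
Defined.

(** [Y] modulo [image_congruence] is abelian and symmetric: once lifted to [X], both sides of each
    identity agree under [eta X]. So this congruence contains the kernel of [eta Y]. *)
Lemma eta_lift (x : X) (y : Y) : eta Y (g x) = eta Y y ->
  exists x', eta X x = eta X x' /\ g x' = y.
Proof.
move=> /class_of_eq /(_ image_congruence) [].
- move=> P Q T U; rewrite -(reprK P) -(reprK Q) -(reprK T) -(reprK U).
  rewrite /= -!class_of_op; apply/class_of_eq.
  have [a <-] := sg (repr P); have [b <-] := sg (repr Q).
  have [c <-] := sg (repr T); have [d <-] := sg (repr U).
  exists ((a <| b) <| (c <| d)), ((a <| c) <| (b <| d)); rewrite !hom_op.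
  by split=> //; apply: absym_abelian.
- move=> P Q; rewrite -(reprK P) -(reprK Q) /= -!class_of_op; apply/class_of_eq.
  have [a <-] := sg (repr P); have [b <-] := sg (repr Q).
  exists (a <| b), (b <| a); rewrite !hom_op.
  by split=> //; apply: absym_symmetric.
- move=> x1 [x2 [gx1 <- e]].
  exact: (eta_permutes (esym gx1) e).
Qed.

Lemma trivial_extensionP : trivial_extension g <->
  forall x x' : X, eta X x = eta X x' -> g x = g x' -> x = x'.
Proof.
have map_eta x : reflection_map g (eta X x) = eta Y (g x) by apply: lift_repr.
split=> [[_ [_ univ]] x x' exx gxx|inj].
  (* The constant maps at [x] and [x'] both mediate the same cone, so they coincide. *)
  have [|m [_ uniq]] := univ X (const_hom X (eta X x)) (const_hom X (g x)).
    by move=> t; apply: map_eta.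
  transitivity (m x).
    exact: (uniq (const_hom X x)).
  by apply/esym/(uniq (const_hom X x')).
split=> //; split=> [x|Q h k hk]; first exact: map_eta.
(* The comparison map to the pullback is always onto, by [eta_lift]; [inj] then makes the chosen
   lifts a homomorphism. *)
have lift t : exists x, eta X x = h t /\ g x = k t.
  have [x hx] := eta_surjective (h t).
  have [|x' [xx' gx']] := @eta_lift x (k t); last by exists x'; rewrite -xx'.
  by rewrite -map_eta hx.
pose m t := proj1_sig (constructive_indefinite_description _ (lift t)).
have mP t : eta X (m t) = h t /\ g (m t) = k t.
  exact: proj2_sig (constructive_indefinite_description _ (lift t)).
have m_op a b : m (a <| b) = m a <| m b.
  have [[ha ka] [hb kb]] := (mP a, mP b); have [hab kab] := mP (a <| b).
  by apply: inj; rewrite hom_op ?ha ?hb ?ka ?kb -hom_op.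
exists (hom_of_op m_op); split.
  by split=> t; case: (mP t).
move=> m' hm km t; have [hmt kmt] := mP t.
by apply: inj; rewrite ?hm ?km ?hmt ?kmt.
Qed.

End ImageOfEta.

(** * Elementwise criteria for normal and central extensions *)

Section Extension.

Variables (A B : quandle) (f : hom A B).

Lemma cong_fst_surjective (R : congruence A) : surjective (cong_fst R).
Proof.
have [Rr _ _] := cong_equiv R.
by move=> a; exists (exist _ (a, a) (Rr a)).
Qed.

Definition ker_pair (a b : A) (ab : f a = f b) :
  cong_quandle (kernel_congruence f) := exist _ (a, b) ab.

Lemma normal_extensionP : surjective f -> normal_extension f <->
  forall (a b c : A) (ab : f a = f b) (ac : f a = f c),
    eta _ (ker_pair ab) = eta _ (ker_pair ac) -> b = c.
Proof.
move=> sf; have triv := trivial_extensionP (cong_fst_surjective (kernel_congruence f)).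
split=> [[_ /triv inj] a b c ab ac e|inj].
  by have [] := f_equal (@proj1_sig _ _) (inj _ _ e erefl).
split=> //; apply/triv => -[[a b] ab] [[a' c] ac] e /= aa.
by subst a'; apply: subset_eq_compat; rewrite (inj a b c ab ac e).
Qed.

Definition fiber_product_snd (E : quandle) (p : hom E B) :
  hom (fiber_product p f) A.
Proof. by exists (fun u => (proj1_sig u).2). Defined.

Lemma fiber_product_fst_surjective (E : quandle) (p : hom E B) :
  surjective f -> surjective (fiber_product_fst p f).
Proof.
by move=> sf e; have [a fa] := sf (p e); exists (exist _ (e, a) (esym fa)).
Qed.

Lemma central_extensionP : surjective f -> central_extension f <->
  exists (E : quandle) (p : hom E B), surjective p /\
    forall (e : E) (a b : A) (ea : p e = f a) (eb : p e = f b),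
      eta (fiber_product p f) (exist _ (e, a) ea) =
      eta (fiber_product p f) (exist _ (e, b) eb) -> a = b.
Proof.
move=> sf.
have triv E (p : hom E B) := trivial_extensionP (@fiber_product_fst_surjective E p sf).
split=> [[_ [E [p [sp /triv inj]]]]|[E [p [sp inj]]]].
  exists E, p; split=> // e a b ea eb eab.
  by have [] := f_equal (@proj1_sig _ _) (inj _ _ eab erefl).
split=> //; exists E, p; split=> //; apply/triv => -[[e a] ea] [[e' b] eb] eab /= ee.
by subst e'; apply: subset_eq_compat; rewrite (inj e a b ea eb eab).
Qed.

(** * Central versus normal extensions *)

Lemma normal_central : normal_extension f -> central_extension f.
Proof.
move=> nf; have [sf _] := nf; apply/central_extensionP => //.
exists A, f; split=> // a b c ab ac e.
apply: ((proj1 (normal_extensionP sf)) nf a b c ab ac).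
pose q : hom (fiber_product f f) (cong_quandle (kernel_congruence f)) :=
  corestrict (cong_closed (kernel_congruence f))
    (h := pair_hom (fiber_product_fst f f) (fiber_product_snd f))
    (fun u => proj2_sig u).
rewrite -[ker_pair ab]/(q (exist _ (a, b) ab)) -[ker_pair ac]/(q (exist _ (a, c) ac)).
exact: (eta_hom q e).
Qed.

Lemma central_fibers : central_extension f -> abelian_symmetric_fibers f.
Proof.
move=> cf; have [sf _] := cf.
have [E [p [sp inj]]] := (proj1 (central_extensionP sf)) cf.
move=> y; have [e pe] := sp y.
(* A fixed [e] gives a homomorphism because [e <| e = e]. *)
pose lift (u : fiber f y) : fiber_product p f :=
  exist _ (e, proj1_sig u) (etrans pe (esym (proj2_sig u))).
have lift_op u v : lift (u <| v) = lift u <| lift v.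
  by apply: subset_eq_compat; rewrite /= qop_idem.
have lift_inj u v : eta _ (lift u) = eta _ (lift v) -> u = v.
  case: u v => [a fa] [b fb] eab.
  by apply: subset_eq_compat; apply: inj eab.
split.
  move=> a b c d; apply: lift_inj; rewrite !lift_op !hom_op.
  exact: absym_abelian.
move=> a b; apply: lift_inj; rewrite !lift_op !hom_op.
exact: absym_symmetric.
Qed.

Lemma fibers_commute (x y : A) :
  abelian_symmetric_fibers f -> f x = f y -> x <| y = y <| x.
Proof.
move=> /(_ (f y)) [_ sym] fxy.
exact: (f_equal (@proj1_sig _ _) (sym (exist _ x fxy) (exist _ y erefl))).
Qed.

Lemma central_normal : central_extension f -> normal_extension f.
Proof.
move=> cf; have [sf _] := cf; have fib := central_fibers cf.
have [E [p [sp inj]]] := (proj1 (central_extensionP sf)) cf.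
apply/normal_extensionP => // a b c ab ac eab.
pose P := fiber_product p f.
(* [Q] holds the [((e, x), y)] with [p e = f x = f y]; [q1], [q2], [q] send them to [(e, x)],
   [(e, y)], [(x, y)]. *)
pose Q := fiber_product (comp_hom p (fiber_product_fst p f)) f.
pose q1 : hom Q P := fiber_product_fst _ f.
pose q3 : hom Q A := fiber_product_snd _.
have ker_eq u : f (fiber_product_snd p (q1 u)) = f (q3 u).
  by rewrite -(proj2_sig u) -(proj2_sig (q1 u)).
pose q : hom Q (cong_quandle (kernel_congruence f)) :=
  corestrict (cong_closed (kernel_congruence f))
    (h := pair_hom (comp_hom (fiber_product_snd p) q1) q3) ker_eq.
pose q2 : hom Q P :=
  corestrict (fiber_product_closed p f)
    (h := pair_hom (comp_hom (fiber_product_fst p f) q1) q3) (fun u => proj2_sig u).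
have sq : surjective q.
  move=> [[x y] xy]; have [e pe] := sp (f x).
  exists (exist _ (exist _ (e, x) pe : P, y) (etrans pe xy)).
  exact: sub_quandle_eq.
have [e pe] := sp (f a).
pose ea : P := exist _ (e, a) pe.
pose u : Q := exist _ (ea, b) (etrans pe ab).
have qu : q u = ker_pair ab by apply: sub_quandle_eq.
have [v [uv qv]] : exists v, eta Q u = eta Q v /\ q v = ker_pair ac.
  by apply: eta_lift => //; rewrite qu.
have pec : p e = f c := etrans pe ac.
apply: (inj e b c (etrans pe ab) pec).
have -> : exist _ (e, b) (etrans pe ab) = malcev (q2 u) (q1 u) ea :> P.
  apply: sub_quandle_eq => /=; congr (_, _); first by rewrite qop_idem qinv_idem.
  by symmetry; apply: malcev_right; apply: fibers_commute.
(* The [E]-component [e'] of [v] is unknown, but [(e <| e') <|^-1 e' = e]. *)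
have -> : exist _ (e, c) pec = malcev (q2 v) (q1 v) ea :> P.
  have [v1 v2] := f_equal (@proj1_sig _ _) qv.
  apply: sub_quandle_eq => /=; rewrite v1 v2 qopK; congr (_, _).
  by symmetry; apply: malcev_right; apply: fibers_commute.
by rewrite !hom_malcev (eta_hom q1 uv) (eta_hom q2 uv).
Qed.

(** * Connectors versus normal extensions *)

Lemma algebraically_central_normal :
  algebraically_central f -> normal_extension f.
Proof.
move=> [sf [fib [p conn]]]; apply/normal_extensionP => // a b c ab ac eab.
(* [tr] sends [(x, y)] to [(y, x, a)]. *)
pose tr (u : cong_quandle (kernel_congruence f)) :
    cong_pullback (kernel_congruence f) (total_congruence A) :=
  triple (R := kernel_congruence f) (S := total_congruence A)
    (esym (proj2_sig u)) (I : total_congruence A _ a).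
have fib_a u : f (p (tr u)) = f a by symmetry; apply: (connector_R conn).
pose phi u : fiber f (f a) := exist _ (p (tr u)) (fib_a u).
have phi_op u v : phi (u <| v) = phi u <| phi v.
  apply: sub_quandle_eq; rewrite -[RHS]/(p (tr u) <| p (tr v)) -hom_op.
  congr (p _).
  by apply: sub_quandle_eq; rewrite /= qop_idem.
have [abF symF] := fib (f a).
pose F := AbsymQuandle abF symF.
have phiE d (ad : f a = f d) : p (tr (ker_pair ad)) = d by apply: (connector_right conn).
rewrite -(phiE b ab) -(phiE c ac).
have /(f_equal (@proj1_sig _ _)) // : phi (ker_pair ab) = phi (ker_pair ac).
by apply: (absym_hom_factors (hom_of_op phi_op : hom _ F)); apply/class_of_eq.
Qed.

Lemma normal_algebraically_central :
  normal_extension f -> algebraically_central f.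
Proof.
move=> nf; have [sf _] := nf; have fib := central_fibers (normal_central nf).
split=> //; split=> //.
pose T := cong_pullback (kernel_congruence f) (total_congruence A).
pose t1 (u : T) := (proj1_sig u).1.1.
pose t2 (u : T) := (proj1_sig u).1.2.
pose t3 (u : T) := (proj1_sig u).2.
pose mal (u : T) := malcev (t1 u) (t2 u) (t3 u).
have t12 (u : T) : f (t1 u) = f (t2 u) by case: u => -[[x y] z] [].
have f_mal (u : T) : f (t3 u) = f (mal u).
  by rewrite hom_malcev t12 malcev_left.
pose pr (u : T) := ker_pair (f_mal u).
have prE u : pr u = malcev (ker_pair (esym (t12 u))) (ker_pair (erefl (f (t2 u))))
                      (ker_pair (erefl (f (t3 u)))).
  by apply: sub_quandle_eq; rewrite /= qopK.
have pr_op u v : eta _ (pr (u <| v)) = eta _ (pr u <| pr v).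
  rewrite hom_op !prE !hom_malcev -malcev_op; first exact: absym_abelian.
  by rewrite -!hom_op; congr (malcev (eta _ _) (eta _ _) (eta _ _));
    apply: sub_quandle_eq.
have mal_op u v : mal (u <| v) = mal u <| mal v.
  have fuv : f (t3 (u <| v)) = f (mal u <| mal v) by rewrite !hom_op -!f_mal.
  (* The two pairs share the first component [t3 (u <| v)] and, by [pr_op], their image under
     [eta]. *)
  apply: ((proj1 (normal_extensionP sf)) nf _ _ _ (f_mal (u <| v)) fuv).
  by rewrite [LHS]pr_op; congr (eta _ _); apply: sub_quandle_eq.
have mal_right x y : f x = f y -> malcev x y y = x.
  by move=> fxy; apply/malcev_right/fibers_commute.
pose p := hom_of_op mal_op : hom T A.
(* For the matrix with rows [a], [b], [c]: [malcev] by columns then across equals [malcev] by rows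
   then down. *)
have p_malcev (a b c : T) :
    malcev (malcev (t1 a) (t1 b) (t1 c)) (malcev (t2 a) (t2 b) (t2 c))
      (malcev (t3 a) (t3 b) (t3 c)) = malcev (mal a) (mal b) (mal c).
  exact: (hom_malcev p a b c).
pose tr (x y z : A) (xy : f x = f y) : T :=
  triple (R := kernel_congruence f) (S := total_congruence A) (z := z) xy I.
exists p; split => //.
- by move=> x y *; apply: malcev_left.
- by move=> x y *; apply: mal_right.
- by move=> x y z r s; apply: (f_mal (triple r s)).
- move=> x y u v yu uv xy s xu.
  (* [p] commutes with [m] on the matrix with rows [(x,y,y)], [(y,y,y)], [(y,u,v)]. *)
  have := p_malcev (@tr x y y xy) (@tr y y u erefl) (@tr y y v erefl).
  by rewrite /mal /t1 /t2 /t3 /= !malcev_left (mal_right x y).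
- move=> x y u v xy yu r uv yv.
  (* The same with rows [(x,y,u)], [(y,y,u)], [(y,y,v)]. *)
  have := p_malcev (@tr x y y xy) (@tr y y y erefl) (@tr u u v erefl).
  by rewrite /mal /t1 /t2 /t3 /= !malcev_left (mal_right x y).
Qed.

End Extension.

Theorem theorem3p13 (A B : quandle) (f : hom A B) (hf : surjective f) :
  (algebraically_central f <-> normal_extension f) /\
  (normal_extension f <-> central_extension f).
Proof.
split; split.
- exact: algebraically_central_normal.
- exact: normal_algebraically_central.
- exact: normal_central.
- exact: central_normal.
Qed.
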